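(* Let $\mathcal{H}$ be a real inner product space with $3\le\dim(\mathcal{H})\le\infty$. Let $A_1,A_2:\mathcal{H}\to\mathcal{H}$ be bounded linear operators such that $\mu_1A_1+\mu_2A_2>0$ for some $\mu_1,\mu_2\in\mathbb{R}$, and let $a_1,a_2\in\mathcal{H}$ and $b_1,b_2\in\mathbb{R}$. For $j=1,2$ define $\phi_j:\mathcal{H}\to\mathbb{R}$ by $\phi_j(x)=\langle A_jx,x\rangle+\langle x,a_j\rangle+b_j$. Then the set $$\Phi(\mathcal{H})=\{(\phi_1(x),\phi_2(x))\in\mathbb{R}^2 : x\in\mathcal{H}\}$$ is convex.
   Context: For a linear operator $T$ on $\mathcal{H}$, $T>0$ (positive definite) means that $T$ is symmetric, i.e. $\langle Tx,y\rangle=\langle x,Ty\rangle$ for all $x,y\in\mathcal{H}$, and $\langle Tx,x\rangle>0$ for all $x\neq 0$. The condition $3\le\dim(\mathcal{H})\le\infty$ means that $\mathcal{H}$ has dimension at least $3$, possibly infinite. $\mathcal{H}$ is not assumed complete. *)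

(* Defs.v *)
From HB Require Import structures.
From mathcomp Require Import all_boot all_order all_algebra.
From mathcomp Require Import classical_sets reals convex.

Set Implicit Arguments.
Unset Strict Implicit.
Unset Printing Implicit Defensive.

Import Order.TTheory GRing.Theory Num.Theory.

Local Open Scope ring_scope.

(* A real inner product space is a left module [H] over [R : realType] together
   with a positive definite symmetric bilinear form [ip : {dot H for idfun}];
   neither finite dimension nor completeness is assumed. *)

Definition lin_indep (R : realType) (H : lmodType R) (n : nat)
    (e : 'I_n -> H) : Prop :=
  forall c : 'I_n -> R, \sum_(i < n) c i *: e i = 0 -> forall i, c i = 0.

(* [n <= dim H <= oo] *)
Definition dim_ge (R : realType) (H : lmodType R) (n : nat) : Prop :=
  exists e : 'I_n -> H, lin_indep e.

Definition ipnorm (R : realType) (H : lmodType R) (ip : {dot H for idfun})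
    (x : H) : R :=
  Num.sqrt (ip x x).

Definition bounded_op (R : realType) (H : lmodType R) (ip : {dot H for idfun})
    (T : {linear H -> H}) : Prop :=
  exists M : R, forall x : H, ipnorm ip (T x) <= M * ipnorm ip x.

Definition symmetric_op (R : realType) (H : lmodType R)
    (ip : {dot H for idfun}) (T : {linear H -> H}) : Prop :=
  forall x y : H, ip (T x) y = ip x (T y).

Definition posdef_op (R : realType) (H : lmodType R) (ip : {dot H for idfun})
    (T : {linear H -> H}) : Prop :=
  symmetric_op ip T /\ forall x : H, x != 0 -> 0 < ip (T x) x.

Definition quad_fun (R : realType) (H : lmodType R) (ip : {dot H for idfun})
    (A : {linear H -> H}) (a : H) (b : R) (x : H) : R :=
  ip (A x) x + ip x a + b.

(* Main.v *)
Require Import Defs.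
From HB Require Import structures.
From mathcomp Require Import all_boot all_order all_algebra.
From mathcomp Require Import classical_sets reals convex.
From mathcomp Require Import interval_inference topology normedtype realfun.
From mathcomp Require Import ring lra.

Set Implicit Arguments.
Unset Strict Implicit.
Unset Printing Implicit Defensive.

Import Order.TTheory GRing.Theory Num.Theory.
Import numFieldNormedType.Exports.

Local Open Scope classical_set_scope.
Local Open Scope ring_scope.

(** Replacing the pair (phi1, phi2) by an invertible linear combination, we may
    assume that the quadratic part P of the first form is positive definite.
    Let x != y, d = x - y, p = l x + (1 - l) y, and let e != 0 be P-orthogonal
    to d.  In the plane p + t d + s e, the points where the first form equals
    its prescribed convex combination form an ellipse.  The line s = 0 cuts this
    ellipse in two points tm <= 0 <= tp, at which the second form minus its own
    convex combination equals k t for one constant k; hence it changes sign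
    along an arc of the ellipse joining them, and vanishes there. *)

(** In the plane above, [t] and [s] are the coordinates along d and e, [al] and [ga] are the values
    of the form of P at d and e, and [c] stands for l (1 - l). The first equation has no [t * s]
    term because e is P-orthogonal to d. *)
Lemma ellipse_IVT (R : realType) (al ga c B C f1 f2 f11 f12 f22 : R) :
    0 < al -> 0 < ga -> 0 <= c ->
  exists t s, B * t + C * s + al * t ^+ 2 + ga * s ^+ 2 = al * c /\
    f1 * t + f2 * s + f11 * t ^+ 2 + f12 * (t * s) + f22 * s ^+ 2 = f11 * c.
Proof.
move=> al0 ga0 c0.
(* Choosing [0 <= C] makes the upper arc [s t] below end at [s = 0]. *)
wlog C0 : C f2 f12 / 0 <= C => [hwlog|].
  have [C0|C0] := leP 0 C; first exact: hwlog.
  have [|t [s [h1 h2]]] := hwlog (- C) (- f2) (- f12).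
    by rewrite oppr_ge0 ltW.
  by exists t, (- s); rewrite -h1 -h2; split; ring.
have hc : 0 <= 4 * al ^+ 2 * c by rewrite mulr_ge0// mulr_ge0// sqr_ge0.
(* [D ^+ 2] is the discriminant of [B * t + al * t ^+ 2 - al * c], whose roots are [tm] and [tp]. *)
pose D := Num.sqrt (B ^+ 2 + 4 * al ^+ 2 * c).
have hD : D ^+ 2 = B ^+ 2 + 4 * al ^+ 2 * c.
  by rewrite sqr_sqrtr// addr_ge0 ?sqr_ge0.
have D0 : 0 <= D by exact: sqrtr_ge0.
pose tm := (- B - D) / (2 * al); pose tp := (- B + D) / (2 * al).
have al_neq0 : al != 0 by rewrite gt_eqF.
have ga_neq0 : ga != 0 by rewrite gt_eqF.
have tmp : tm <= tp by rewrite ler_pM2r ?invr_gt0 ?mulr_gt0//; lra.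
have qE t : B * t + al * t ^+ 2 - al * c = al * ((t - tm) * (t - tp)).
  have -> : c = (D ^+ 2 - B ^+ 2) / (4 * al ^+ 2).
    by rewrite hD; field; rewrite ?al_neq0.
  by rewrite /tm /tp; field.
(* For fixed [t] the ellipse equation is quadratic in [s], with discriminant [disc t] and larger
   root [s t]. Since [Num.sqrt] is 0 on negative reals, [s] is continuous on the whole line, even
   outside the ellipse. *)
pose disc t := C ^+ 2 - 4 * ga * (B * t + al * t ^+ 2 - al * c).
pose s t := (Num.sqrt (disc t) - C) / (2 * ga).
pose F t := f1 * t + f2 * s t + f11 * t ^+ 2 + f12 * (t * s t) +
            f22 * s t ^+ 2 - f11 * c.
have q_tm : B * tm + al * tm ^+ 2 - al * c = 0 by rewrite qE subrr mul0r mulr0.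
have q_tp : B * tp + al * tp ^+ 2 - al * c = 0 by rewrite qE subrr !mulr0.
have s0 t : B * t + al * t ^+ 2 - al * c = 0 -> s t = 0.
  by move=> qt; rewrite /s /disc qt mulr0 subr0 sqrtr_sqr ger0_norm// subrr mul0r.
(* At a root, [t ^+ 2 = c - B * t / al], so the constant [f11 * c] cancels and only a multiple of
   [t] remains. *)
have F0 t : B * t + al * t ^+ 2 - al * c = 0 -> F t = t * (f1 - f11 * B / al).
  move=> qt; rewrite /F (s0 _ qt).
  have -> : t ^+ 2 = c - B * t / al.
    apply: (mulfI al_neq0); rewrite mulrBr [al * (_ / _)]mulrC divfK//; lra.
  by field.
have tm0 : tm <= 0.
  rewrite pmulr_lle0 ?invr_gt0 ?mulr_gt0//.
  suff : - B <= D by lra.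
  rewrite (le_trans (ler_norm _))// normrN -sqrtr_sqr ler_wsqrtr//.
  by rewrite lerDl.
have tp0 : 0 <= tp.
  rewrite pmulr_lge0 ?invr_gt0 ?mulr_gt0//.
  suff : B <= D by lra.
  rewrite (le_trans (ler_norm _))// -sqrtr_sqr ler_wsqrtr//.
  by rewrite lerDl.
have cF : continuous F.
  have cs : continuous s.
    move=> t; apply: cvgM; last exact: cvg_cst.
    apply: cvgB; last exact: cvg_cst.
    apply: (@continuous_comp _ _ _ disc Num.sqrt); last exact: sqrt_continuous.
    apply: cvgB; first exact: cvg_cst.
    apply: cvgM; first exact: cvg_cst.
    apply: cvgB; last exact: cvg_cst.
    apply: cvgD; apply: cvgM; (try exact: cvg_cst); first exact: cvg_id.
    exact: exprn_continuous.
  move=> t; apply: cvgB; last exact: cvg_cst.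
  apply: cvgD; [apply: cvgD; [apply: cvgD; [apply: cvgD|]|]|];
    (apply: cvgM; first exact: cvg_cst).
  - exact: cvg_id.
  - exact: cs.
  - exact: exprn_continuous.
  - by apply: cvgM; [exact: cvg_id|exact: cs].
  - by apply: (@continuous_comp _ _ _ s (fun x => x ^+ 2));
      [exact: cs|exact: exprn_continuous].
have [||t /[!in_itv]/= /andP[tmt ttp] Ft0] := @IVT R F tm tp 0 tmp.
- by apply: continuous_subspaceT.
- rewrite (F0 _ q_tm) (F0 _ q_tp) ge_min le_max.
  set k := f1 - _; have [k0|/ltW k0] := leP 0 k.
    by rewrite (mulr_le0_ge0 tm0 k0) (mulr_ge0 tp0 k0) orbT.
  by rewrite (mulr_ge0_le0 tp0 k0) (mulr_le0 tm0 k0) orbT.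
exists t, (s t); split; last by move: Ft0; rewrite /F; lra.
(* Between the roots the quadratic in [t] is nonpositive, so the square root in [s t] is a genuine
   one and [s t] solves the ellipse equation. *)
have disc0 : 0 <= disc t.
  have tq : (t - tm) * (t - tp) <= 0 by rewrite mulr_ge0_le0 ?subr_ge0 ?subr_le0.
  rewrite /disc qE -mulrN addr_ge0 ?sqr_ge0// mulr_ge0//.
    by rewrite mulr_ge0// ltW.
  by rewrite oppr_ge0 (mulr_ge0_le0 (ltW al0) tq).
suff : C * s t + ga * s t ^+ 2 = - (B * t + al * t ^+ 2 - al * c) by lra.
have := sqr_sqrtr disc0; rewrite /s; set r := Num.sqrt _ => hr.
transitivity ((r ^+ 2 - C ^+ 2) / (4 * ga)); first by field.
by rewrite hr /disc; field.
Qed.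

Lemma lin_indep_sum_neq0 (R : realType) (H : lmodType R) n (e : 'I_n -> H)
    (c : 'I_n -> R) (i : 'I_n) :
  lin_indep e -> c i != 0 -> \sum_(j < n) c j *: e j != 0.
Proof. by move=> eI; apply: contraNneq => /eI ->. Qed.

Lemma lin_indep_neq0 (R : realType) (H : lmodType R) n (e : 'I_n -> H) i :
  lin_indep e -> e i != 0.
Proof.
move=> eI; have : \sum_j (j == i)%:R *: e j != 0.
  by apply: (lin_indep_sum_neq0 (i := i)) => //; rewrite eqxx oner_eq0.
rewrite (bigD1 i)//= eqxx scale1r big1 ?addr0// => j /negPf ->.
by rewrite scale0r.
Qed.

(** [L] kills [L (e i1) *: e i0 - L (e i0) *: e i1], which independence keeps nonzero once
    [L (e i0) != 0]. This supplies the direction e. *)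
Lemma dim_ge2_ker (R : realType) (H : lmodType R) n (L : {scalar H}) :
  dim_ge H n.+2 -> exists2 v, v != 0 & L v = 0.
Proof.
move=> [e eI]; pose i0 : 'I_n.+2 := ord0; pose i1 : 'I_n.+2 := lift ord0 ord0.
have [L0|L0] := eqVneq (L (e i0)) 0.
  exists (e i0) => //.
  exact: lin_indep_neq0.
exists (L (e i1) *: e i0 - L (e i0) *: e i1); last first.
  by rewrite linearP /= -scaleNr linearZ_LR /= mulNr mulrC subrr.
pose c j := if j == i0 then L (e i1) else if j == i1 then - L (e i0) else 0.
have := lin_indep_sum_neq0 (c := c) (i := i1) eI.
rewrite (bigD1 i0)// (bigD1 i1)//= big1 => [|j /andP[/negPf j0 /negPf j1]].
  by rewrite addr0 /c/= scaleNr oppr_eq0; exact.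
by rewrite /c j0 j1 scale0r.
Qed.

Lemma quad_fun_plane (R : realType) (H : lmodType R) (ip : {dot H for idfun})
    (A : {linear H -> H}) (a : H) (b : R) (x d e : H) (t s : R) :
  quad_fun ip A a b (x + t *: d + s *: e) = quad_fun ip A a b x +
    (ip (A x) d + ip (A d) x + ip d a) * t +
    (ip (A x) e + ip (A e) x + ip e a) * s +
    ip (A d) d * t ^+ 2 + (ip (A d) e + ip (A e) d) * (t * s) +
    ip (A e) e * s ^+ 2.
Proof.
rewrite /quad_fun !(linearD, linearZ_LR)/= !(linearDl, linearZl_LR)/=.
by rewrite ?(linearDr, linearZr_LR)/=; ring.
Qed.

(** The affine parts cancel, so only the quadratic part contributes to the defect. This is where
    [al * c] and [f11 * c] in [ellipse_IVT] come from. *)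
Lemma quad_fun_conv (R : realType) (H : lmodType R) (ip : {dot H for idfun})
    (A : {linear H -> H}) (a : H) (b : R) (x y : H) (l : R) :
  l * quad_fun ip A a b x + (1 - l) * quad_fun ip A a b y =
  quad_fun ip A a b (l *: x + (1 - l) *: y) +
    ip (A (x - y)) (x - y) * (l * (1 - l)).
Proof.
rewrite /quad_fun !(linearD, linearN, linearZ_LR)/=.
rewrite !(linearDl, linearNl, linearZl_LR)/=.
by rewrite ?(linearDr, linearNr, linearZr_LR)/=; ring.
Qed.

Lemma quad_fun_lincomb (R : realType) (H : lmodType R) (ip : {dot H for idfun})
    (A1 A2 : {linear H -> H}) (a1 a2 : H) (b1 b2 m1 m2 : R) (x : H) :
  quad_fun ip (m1 \*: A1 \+ m2 \*: A2) (m1 *: a1 + m2 *: a2)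
    (m1 * b1 + m2 * b2) x =
  m1 * quad_fun ip A1 a1 b1 x + m2 * quad_fun ip A2 a2 b2 x.
Proof.
rewrite /quad_fun /= !(linearDl, linearZl_LR)/=.
by rewrite !(linearDr, linearZr_LR)/=; ring.
Qed.

Lemma quad_fun_pair_conv (R : realType) (H : lmodType R) (ip : {dot H for idfun})
    n (A F : {linear H -> H}) (a f : H) (b g : R) (x y : H) (l : R) :
    dim_ge H n.+2 -> (forall v, v != 0 -> 0 < ip (A v) v) -> 0 <= l <= 1 ->
  exists z,
    quad_fun ip A a b z = l * quad_fun ip A a b x + (1 - l) * quad_fun ip A a b y
    /\
    quad_fun ip F f g z = l * quad_fun ip F f g x + (1 - l) * quad_fun ip F f g y.
Proof.
move=> Hn A0 /andP[l0 l1].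
have [->|xy] := eqVneq x y; first by exists y; split; ring.
pose d := x - y; have d0 : d != 0 by rewrite subr_eq0.
(* The coefficient of [t * s] in [quad_fun_plane] for the directions [d] and [v]. *)
pose L v := ip (A d) v + ip (A v) d.
have L_scalar : scalar L.
  by move=> k u v; rewrite /L !linearP/= linearPl/=; ring.
pose Ls : {scalar H} :=
  HB.pack L (GRing.isLinear.Build R H R *%R L L_scalar).
have [e e0 Le] := dim_ge2_ker Ls Hn.
have c0 : 0 <= l * (1 - l) by rewrite mulr_ge0// subr_ge0.
pose p := l *: x + (1 - l) *: y.
have [t [s [hA hF]]] := ellipse_IVT
  (ip (A p) d + ip (A d) p + ip d a) (ip (A p) e + ip (A e) p + ip e a)
  (ip (F p) d + ip (F d) p + ip d f) (ip (F p) e + ip (F e) p + ip e f)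
  (ip (F d) d) (ip (F d) e + ip (F e) d) (ip (F e) e)
  (A0 _ d0) (A0 _ e0) c0.
exists (p + t *: d + s *: e); rewrite !quad_fun_plane !quad_fun_conv -/p -/d.
split; last by rewrite -hF; ring.
by rewrite -hA [X in X * (t * s)]Le; ring.
Qed.

Theorem proposition3p1 (R : realType) (H : lmodType R) (ip : {dot H for idfun})
    (hdim : dim_ge H 3)
    (A1 A2 : {linear H -> H})
    (hA1 : bounded_op ip A1) (hA2 : bounded_op ip A2)
    (hpos : exists mu1 mu2 : R, posdef_op ip (mu1 \*: A1 \+ mu2 \*: A2))
    (a1 a2 : H) (b1 b2 : R) :
  @convex_set R (R^o * R^o)%type
    [set (quad_fun ip A1 a1 b1 x, quad_fun ip A2 a2 b2 x) | x in [set: H]].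
Proof.
have [m1 [m2 [_ P0]]] := hpos.
move=> _ _ l /set_mem[x _ <-] /set_mem[y _ <-]; apply/mem_set.
have l01 : 0 <= l%:num <= 1 by rewrite ge0 le1.
(* The second combination completes the first to a matrix with rows (m1, m2) and (-m2, m1), of
   determinant [m1 ^+ 2 + m2 ^+ 2]. *)
have [z []] := quad_fun_pair_conv (- m2 \*: A1 \+ m1 \*: A2)
  (m1 *: a1 + m2 *: a2) (- m2 *: a1 + m1 *: a2)
  (m1 * b1 + m2 * b2) (- m2 * b1 + m1 * b2) x y hdim P0 l01.
rewrite !quad_fun_lincomb => hP hF.
(* If both coefficients vanished, the positive operator would be zero, although a nonzero vector
   exists. *)
have m0 : m1 ^+ 2 + m2 ^+ 2 != 0.
  have [e eI] := hdim; apply/eqP => /eqP.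
  rewrite paddr_eq0 ?sqr_ge0// !sqrf_eq0 => /andP[/eqP m10 /eqP m20].
  have := P0 _ (lin_indep_neq0 ord0 eI).
  by rewrite m10 m20 /= !scale0r addr0 linear0l ltxx.
suff [h1 h2] :
    quad_fun ip A1 a1 b1 z =
      l%:num * quad_fun ip A1 a1 b1 x + (1 - l%:num) * quad_fun ip A1 a1 b1 y /\
    quad_fun ip A2 a2 b2 z =
      l%:num * quad_fun ip A2 a2 b2 x + (1 - l%:num) * quad_fun ip A2 a2 b2 y.
  by exists z => //; rewrite h1 h2.
(* The transposed matrix inverts the change of forms up to the determinant. *)
split; apply: (mulfI m0).
- transitivity (m1 * (m1 * quad_fun ip A1 a1 b1 z + m2 * quad_fun ip A2 a2 b2 z)
    - m2 * (- m2 * quad_fun ip A1 a1 b1 z + m1 * quad_fun ip A2 a2 b2 z)).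
    by ring.
  by rewrite hP hF; ring.
- transitivity (m2 * (m1 * quad_fun ip A1 a1 b1 z + m2 * quad_fun ip A2 a2 b2 z)
    + m1 * (- m2 * quad_fun ip A1 a1 b1 z + m1 * quad_fun ip A2 a2 b2 z)).
    by ring.
  by rewrite hP hF; ring.
Qed.
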